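(* Let $\mathcal{Z}\subset\mathbb{R}^d$ be a sample space, $P$ a probability distribution on $\mathcal{Z}$, $z_1,\dots,z_n$ iid samples from $P$, and $\mathcal{F}$ a function class. Let $\ell:\mathcal{F}\times\mathcal{Z}\to\mathbb{R}$ be a loss function, let $f^*\in\arg\min_{f\in\mathcal{F}}\mathbb{E}_P[\ell(f,z)]$, and let $\mathcal{K}$ be an ambiguity set, i.e. a (data-dependent) set of probability distributions on $\mathcal{Z}$ constructed from the samples. Then any distributionally robust optimization (DRO) solution $$f^*_{\mathrm{dro}}\in\arg\min_{f\in\mathcal{F}}\max_{Q\in\mathcal{K}}\mathbb{E}_Q[\ell(f,z)]$$ satisfies, for every $\varepsilon>0$, $$\mathbb{P}\big[\mathbb{E}_P[\ell(f^*_{\mathrm{dro}},z)]-\mathbb{E}_P[\ell(f^*,z)]>\varepsilon\big]\le \mathbb{P}[P\notin\mathcal{K}]+\mathbb{P}\Big[\max_{Q\in\mathcal{K}}\mathbb{E}_Q[\ell(f^*,z)]-\mathbb{E}_P[\ell(f^*,z)]>\varepsilon\,\Big|\,P\in\mathcal{K}\Big].$$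
   Context: $\mathbb{E}_Q[\ell(f,z)]$ denotes the expectation of $\ell(f,z)$ over $z\sim Q$ with $f$ held fixed; thus $\mathbb{E}_P[\ell(f^*_{\mathrm{dro}},z)]$ is evaluated with $z$ independent of the samples and is a random variable depending on the samples through $f^*_{\mathrm{dro}}$. The outer probability $\mathbb{P}$ is over the random samples $z_1,\dots,z_n$ (on which $\mathcal{K}$ and $f^*_{\mathrm{dro}}$ depend). It is implicitly assumed that $f^*$ and $f^*_{\mathrm{dro}}$ exist, that the expectations and maxima appearing are well defined and finite, and that the events considered are measurable. If $\mathbb{P}[P\in\mathcal{K}]=0$, the conditional probability is interpreted as an arbitrary number in $[0,1]$. *)

(* Defs.v *)
From HB Require Import structures.
From mathcomp Require Import all_boot all_order all_algebra.
From mathcomp Require Import all_classical all_reals all_analysis.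
From mathcomp Require Import giry.

Set Implicit Arguments.
Unset Strict Implicit.
Unset Printing Implicit Defensive.

Import Order.TTheory GRing.Theory Num.Theory.
Import numFieldNormedType.Exports.

Local Open Scope classical_set_scope.
Local Open Scope ring_scope.

(* R^d with its Borel sigma-algebra. *)
Definition borel_space (R : realType) (d : nat) : Type :=
  g_sigma_algebraType (@open 'rV[R]_d).

HB.instance Definition _ (R : realType) (d : nat) :=
  Measurable.on (borel_space R d).

(* The subset Z of R^d as a measurable space, with the trace of the Borel
   sigma-algebra; Z itself need not be Borel.  Measurable types are pointed,
   hence the proof of nonemptiness (which holds as soon as Z carries a
   probability distribution). *)
Definition sample_space (R : realType) (d : nat) (Z : set (borel_space R d))
  (Z0 : Z !=set0) : Type := set_type Z.

Section sample_space_measurable.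
Context (R : realType) (d : nat) (Z : set (borel_space R d)) (Z0 : Z !=set0).

HB.instance Definition _ := Choice.on (sample_space Z0).

HB.instance Definition _ := isPointed.Build (sample_space Z0)
  (SigSub (mem_set (svalP (cid Z0)))).

Definition sample_val (z : sample_space Z0) : borel_space R d := set_val z.

HB.instance Definition _ :=
  Measurable.copy (sample_space Z0) (g_sigma_algebra_preimageType sample_val).

End sample_space_measurable.

Section iid.
Context (dO dT : measure_display) (Omega : measurableType dO)
  (T : measurableType dT) (R : realType) (PP : probability Omega R) (n : nat).

Definition mutually_independent (z : 'I_n -> {RV PP >-> T}) : Prop :=
  forall (J : {set 'I_n}) (A : 'I_n -> set T), (forall i, measurable (A i)) ->
    PP (\bigcap_(i in [set` J]) (z i @^-1` A i)) =
    (\prod_(i in J) PP (z i @^-1` A i))%E.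

Definition iid (P : probability T R) (z : 'I_n -> {RV PP >-> T}) : Prop :=
  mutually_independent z /\
  forall i (A : set T), measurable A -> distribution PP (z i) A = P A.

Definition sample (z : 'I_n -> {RV PP >-> T}) (w : Omega) : n.-tuple T :=
  [tuple z i w | i < n].

End iid.

Section dro.
Context (dT : measure_display) (T : measurableType dT) (R : realType).

(* Measures of the library may differ outside the measurable sets, so that
   "P belongs to K" is read up to equality on measurable sets. *)
Definition contains_law (K : set (probability T R)) (P : probability T R) :
  Prop := exists2 Q : probability T R, K Q & measure_eq Q P.

Context (H : Type) (l : H -> T -> R).

Definition risk (Q : probability T R) (f : H) : \bar R := 'E_Q[l f]%E.

(* The maximum over K is encoded as a supremum, always assumed to be attained
   (worst_risk_attained). *)
Definition worst_risk (K : set (probability T R)) (f : H) : \bar R :=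
  ereal_sup [set risk Q f | Q in K].

Definition worst_risk_attained (K : set (probability T R)) (f : H) : Prop :=
  exists2 Q, K Q & risk Q f = worst_risk K f.

Definition finite_risk (Q : probability T R) (f : H) : Prop :=
  Q.-integrable setT (EFin \o l f).

End dro.

Definition argmin (R : realType) (H : Type) (F : set H) (J : H -> \bar R) :
  set H := [set f | F f /\ forall g, F g -> (J f <= J g)%E].

(* P[A | B], with an arbitrary value c when B has probability zero. *)
Definition cond_prob (dO : measure_display) (Omega : measurableType dO)
    (R : realType) (PP : probability Omega R) (c : R) (A B : set Omega) : R :=
  if PP B == 0%E then c else fine (PP (A `&` B)) / fine (PP B).

(* Main.v *)
Require Import Defs.
From HB Require Import structures.
From mathcomp Require Import all_boot all_order all_algebra.
From mathcomp Require Import all_classical all_reals all_analysis.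
From mathcomp Require Import giry.

Set Implicit Arguments.
Unset Strict Implicit.
Unset Printing Implicit Defensive.

Import Order.TTheory GRing.Theory Num.Theory.
Import numFieldNormedType.Exports.

Local Open Scope classical_set_scope.
Local Open Scope ring_scope.

(** When [P] lies in [K], the worst-case risk dominates the true risk, so
    [risk P fdro <= worst_risk K fdro <= worst_risk K fstar]
    ([risk_argmin_worst_risk_le]).  Hence an excess risk above [eps] forces
    either [P] to lie outside [K], or [P] to lie in [K] while the worst-case
    risk of [fstar] exceeds its true risk by more than [eps].  A union bound
    then concludes, because the probability of the intersection of two events
    is at most the corresponding conditional probability
    ([probability_setI_le_cond_prob]). *)

Section risk_bounds.
Context (dT : measure_display) (T : measurableType dT) (R : realType).
Context (H : Type) (l : H -> T -> R).

Lemma eq_risk (P Q : probability T R) (f : H) :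
  measure_eq Q P -> risk l Q f = risk l P f.
Proof.
move=> QP; rewrite /risk unlock.
by apply: eq_measure_integral => A mA _; exact: QP.
Qed.

Lemma risk_le_worst_risk (K : set (probability T R)) (P : probability T R)
    (f : H) :
  contains_law K P -> (risk l P f <= worst_risk l K f)%E.
Proof.
by case=> Q KQ QP; rewrite -(eq_risk f QP); apply: ereal_sup_ubound; exists Q.
Qed.

Lemma risk_argmin_worst_risk_le (F : set H) (K : set (probability T R))
    (P : probability T R) (f g : H) :
  contains_law K P -> argmin F (worst_risk l K) f -> F g ->
  (risk l P f <= worst_risk l K g)%E.
Proof.
by move=> KP [_ fmin] Fg; exact: le_trans (risk_le_worst_risk f KP) (fmin g Fg).
Qed.

End risk_bounds.

(** The convention for a null conditioning event is harmless: the left-hand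
    side then vanishes, and only [0 <= c] matters. *)
Lemma probability_setI_le_cond_prob (dO : measure_display)
    (Omega : measurableType dO) (R : realType) (PP : probability Omega R)
    (c : R) (A B : set Omega) :
  measurable A -> measurable B -> 0 <= c ->
  (PP (A `&` B) <= (cond_prob PP c A B)%:E)%E.
Proof.
move=> mA mB c0; have mAB := measurableI _ _ mA mB.
rewrite /cond_prob; case: eqP => [B0|/eqP B0].
  apply: (@le_trans _ _ 0%E); last by rewrite lee_fin.
  by rewrite -B0; apply: le_measure; rewrite ?inE//; exact: subIsetr.
have Bfin : PP B \is a fin_num by exact: fin_num_measure.
have B_gt0 : 0 < fine (PP B).
  by rewrite lt_def fine_ge0 ?measure_ge0// fine_eq0// B0.
have B_le1 : fine (PP B) <= 1.
  by rewrite -lee_fin fineK// probability_le1.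
rewrite -[leLHS]fineK ?fin_num_measure// lee_fin ler_pdivlMr//.
by rewrite ler_piMr// fine_ge0// measure_ge0.
Qed.

Theorem theorem3p1
  (R : realType) (d n : nat)
  (Z : set (borel_space R d)) (Z0 : Z !=set0)
  (P : probability (sample_space Z0) R)
  (dO : measure_display) (Omega : measurableType dO)
  (PP : probability Omega R)
  (z : 'I_n -> {RV PP >-> sample_space Z0})
  (z_iid : iid P z)
  (H : Type) (F : set H) (l : H -> sample_space Z0 -> R)
  (fstar : H) (fstar_argmin : argmin F (risk l P) fstar)
  (K : n.-tuple (sample_space Z0) -> set (probability (sample_space Z0) R))
  (fdro : n.-tuple (sample_space Z0) -> H)
  (fdro_argmin : forall w,
    argmin F (worst_risk l (K (sample z w))) (fdro (sample z w)))
  (finite_P : forall f, F f -> finite_risk l P f)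
  (finite_K : forall w Q f, K (sample z w) Q -> F f -> finite_risk l Q f)
  (max_K : forall w f, F f -> worst_risk_attained l (K (sample z w)) f)
  (eps : R) (eps_gt0 : 0 < eps)
  (mcontains : measurable [set w | contains_law (K (sample z w)) P])
  (mexcess : measurable
    [set w | (risk l P (fdro (sample z w)) - risk l P fstar > eps%:E)%E])
  (mworst : measurable
    [set w | (worst_risk l (K (sample z w)) fstar - risk l P fstar > eps%:E)%E])
  (c : R) (c01 : 0 <= c <= 1) :
  (PP [set w | (risk l P (fdro (sample z w)) - risk l P fstar > eps%:E)%E]
   <= PP [set w | ~ contains_law (K (sample z w)) P]
      + (cond_prob PP c
           [set w | (worst_risk l (K (sample z w)) fstar - risk l P fstar
                     > eps%:E)%E]
           [set w | contains_law (K (sample z w)) P])%:E)%E.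
Proof.
set A := [set w | (risk l P _ - _ > _)%E].
set B := [set w | contains_law _ _].
set C := [set w | (worst_risk _ _ _ - _ > _)%E].
have sub : A `<=` ~` B `|` (C `&` B).
  move=> w Aw; have [Bw|nBw] := pselect (B w); [right|by left].
  split=> //; apply: (lt_le_trans Aw); apply: leeB => //.
  exact: risk_argmin_worst_risk_le Bw (fdro_argmin w) fstar_argmin.1.
have mnB : measurable (~` B) by exact: measurableC.
have mCB : measurable (C `&` B) by exact: measurableI.
have c_ge0 : 0 <= c by case/andP: c01.
apply: (@le_trans _ _ (PP (~` B `|` (C `&` B)))).
  by apply: le_measure; rewrite ?inE//; exact: measurableU.
apply: (le_trans (measureU2 PP mnB mCB)).
by apply: leeD2l; exact: probability_setI_le_cond_prob.
Qed.
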